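(* Let $K$ be a number field with ring of integers $O_K$. Let $f(x)=x^d+c$, $d\ge 2$, where $c=c_1/c_2$ with $c_1,c_2\in O_K$ relatively prime in $O_K$. Assume that there is a prime $p$ in $O_K$ such that $\gcd(\nu_p(c_1),d)=1$, where $\nu_p$ is the valuation of $K$ at the prime $p$. Then $f(x)$ is stable over $K$.
   Context: The iterates of $f$ are $f^1=f$ and $f^m(x)=f(f^{m-1}(x))$ for $m\ge 2$. A polynomial $f(x)$ is stable over a field $K$ if $f^n(x)$ is irreducible over $K$ for every $n\ge 1$. *)

(* Defs.v *)
From HB Require Import structures.
From mathcomp Require Import all_boot all_order all_algebra all_field.
From mathcomp Require Import ring_quotient.
From mathcomp Require Import boolp classical_sets.

Set Implicit Arguments.
Unset Strict Implicit.
Unset Printing Implicit Defensive.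

Import GRing.Theory.
Local Open Scope ring_scope.

Section RingOfIntegers.
Variable K : fieldExtType rat.

Definition algInt : {pred K} := [pred x | `[< integralOver (intr : int -> K) x >]].

Lemma algIntP x : reflect (integralOver (intr : int -> K) x) (x \in algInt).
Proof. exact: asboolP. Qed.

Lemma algInt_subring : subring_closed algInt.
Proof.
split; first by apply/algIntP; apply: integral1.
  by move=> x y /algIntP xI /algIntP yI; apply/algIntP; apply: integral_sub.
by move=> x y /algIntP xI /algIntP yI; apply/algIntP; apply: integral_mul.
Qed.

HB.instance Definition _ := GRing.isSubringClosed.Build K algInt algInt_subring.

Record ringOfIntegers := RingOfIntegers {
  ringOfIntegers_val :> K;
  _ : ringOfIntegers_val \in algInt }.

HB.instance Definition _ := [isSub for ringOfIntegers_val].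
HB.instance Definition _ := [Choice of ringOfIntegers by <:].
HB.instance Definition _ :=
  [SubChoice_isSubComNzRing of ringOfIntegers by <:].

End RingOfIntegers.

Section Ideals.
Variable R : comNzRingType.
Local Open Scope classical_set_scope.

(* Relatively prime in the sense of ideals: (a) + (b) = R. *)
Definition rel_prime (a b : R) : Prop := exists u v : R, u * a + v * b = 1.

Definition ideal_mul (I J : set R) : set R :=
  [set x | exists2 s : seq (R * R),
     (forall z, z \in s -> I z.1 /\ J z.2) & x = \sum_(z <- s) z.1 * z.2].

Definition ideal_exp (I : set R) (n : nat) : set R :=
  iter n (ideal_mul I) setT.

(* The largest n such that x lies in I ^ n; the value 0 is returned when there
   is no largest n, in particular for x = 0. *)
Definition ideal_ord (I : set R) (x : R) : nat :=
  xget 0%N [set n | ideal_exp I n x /\ ~ ideal_exp I n.+1 x].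

End Ideals.

(* The p-adic valuation on K: ord_p a - ord_p b at a / b, for nonzero a and b
   in the ring of integers. The value at 0, mathematically +oo, is 0 here, so
   that its gcd with any d >= 2 is d, which is not 1. *)
Definition valuation (K : fieldExtType rat)
    (p : prime_idealr (ringOfIntegers K)) (x : K) : int :=
  xget 0 [set n : int | exists a b : ringOfIntegers K,
    [/\ a != 0, b != 0, x = (a : K) / (b : K)
      & n = (ideal_ord [set` p] a)%:Z - (ideal_ord [set` p] b)%:Z]]%classic.

Definition poly_iter (F : fieldType) (f : {poly F}) (n : nat) : {poly F} :=
  iter n (fun g => f \Po g) 'X.

Definition stable (F : fieldType) (f : {poly F}) : Prop :=
  forall n : nat, (1 <= n)%N -> irreducible_poly (poly_iter f n).

(* Main.v *)
Require Import Defs.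
From HB Require Import structures.
From mathcomp Require Import all_boot all_order all_algebra all_field.
From mathcomp Require Import ring_quotient.
From mathcomp Require Import boolp classical_sets.
From mathcomp Require Import zify ring.

(** Write [r] for the valuation of [c1] at [p]. It is nonnegative since [c1] is
    integral and nonzero since [gcd (r, d) = 1 < d], so [p] divides [c1]; as
    [c1] and [c2] are comaximal, [p] does not divide [c2], and [c = c1 / c2]
    has valuation [r > 0]. Modulo [c] the polynomial [f] is ['X^d], hence the
    [n]-th iterate is ['X^(d ^ n)] modulo [c] ([poly_iter_shape]). Its constant
    term is [y ^+ d + c] with [y] of valuation at least [r], so it has valuation
    exactly [r]. The Newton polygon of the iterate is therefore a single segment
    from [(0, r)] to [(d ^ n, 0)], and [r] is prime to [d ^ n]: the polynomial
    is irreducible by the criterion of Dumas ([dumas_irreducible]), whose proof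
    is a Gauss lemma for the weighted valuation
    [min_i (D * v a_i + r * i)] on polynomials ([min_wt_mul]).

    All this needs a genuine valuation [v] on [K] that agrees with the one
    defined through powers of the ideal [p] ([exists_prime_valuation]), that is,
    the fact that the localization [loc] of the ring of integers at [p] is a
    discrete valuation ring. It is obtained without ideal factorization:
    - [loc] is a valuation ring ([loc_or_locV]). An element [x] is a root of an
      integer polynomial [q] whose coefficients are not all divisible by the
      residue characteristic [l]. The Horner tails [b_k] of [q] at [x], and the
      products [x * b_k], are algebraic integers ([algInt_horner_drop]), and the
      coefficients of [q] are differences of them; so one of these numbers lies
      outside [p], which writes [x] or its inverse as a fraction with
      denominator outside [p].
    - The value group is discrete ([uniformizer]) and archimedean
      ([int_bounded_order]). Elements whose valuations are distinct and lie
      between 0 (excluded) and [v l] are linearly independent over the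
      rationals, because a multiple of [l] moves a valuation out of that range;
      so a chain of such elements has length at most the degree of [K]
      ([chain_bound]).
    - [p] is maximal ([inverse_mod]), so the power [p ^ n] is the trace on the
      ring of integers of the [n]-th power of the maximal ideal of [loc]
      ([ideal_exp_loc]). *)

Set Implicit Arguments.
Unset Strict Implicit.
Unset Printing Implicit Defensive.

Import Order.TTheory GRing.Theory Num.Theory.
Local Open Scope ring_scope.

(** * Integer-valued valuations and the irreducibility criterion of Dumas *)

Section Valuation.
Variables (F : fieldType) (v : F -> int).

(** The disjunct [x == 0] stands for an infinite valuation at 0: nothing is
    assumed about the integer [v 0]. *)
Definition val_ge (k : int) (x : F) : bool := (x == 0) || (k <= v x).

Definition is_valuation : Prop :=
  (forall x y, x != 0 -> y != 0 -> v (x * y) = v x + v y) /\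
  (forall k x y, val_ge k x -> val_ge k y -> val_ge k (x + y)).

Hypothesis v_val : is_valuation.

Lemma val_ge0 k : val_ge k 0.
Proof. by rewrite /val_ge eqxx. Qed.

Lemma val_geE k x : x != 0 -> val_ge k x = (k <= v x).
Proof. by rewrite /val_ge => /negPf->. Qed.

Lemma val_ge_le k l x : l <= k -> val_ge k x -> val_ge l x.
Proof.
by rewrite /val_ge => lk /orP[->//|kx]; rewrite (le_trans lk kx) orbT.
Qed.

Lemma val_mul x y : x != 0 -> y != 0 -> v (x * y) = v x + v y.
Proof. by case: v_val => vM _; apply: vM. Qed.

Lemma val_geD k x y : val_ge k x -> val_ge k y -> val_ge k (x + y).
Proof. by case: v_val => _; apply. Qed.

Lemma val_one : v 1 = 0.
Proof.
have := val_mul (oner_neq0 F) (oner_neq0 F); rewrite mulr1.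
by move=> e; apply: (addrI (v 1)); rewrite addr0 -e.
Qed.

Lemma val_opp x : v (- x) = v x.
Proof.
have [->|x0] := eqVneq x 0; first by rewrite oppr0.
have n1 : (-1 : F) != 0 by rewrite oppr_eq0 oner_eq0.
have : v (-1) + v (-1) = 0 by rewrite -val_mul // mulrNN mulr1 val_one.
move/eqP; rewrite -mulr2n mulrn_eq0 /= => /eqP v_opp1.
by rewrite -[- x]mulN1r val_mul // v_opp1 add0r.
Qed.

Lemma val_geN k x : val_ge k (- x) = val_ge k x.
Proof. by rewrite /val_ge oppr_eq0 val_opp. Qed.

Lemma val_geM k l x y : val_ge k x -> val_ge l y -> val_ge (k + l) (x * y).
Proof.
have [->|x0] := eqVneq x 0; first by rewrite mul0r !val_ge0.
have [->|y0] := eqVneq y 0; first by rewrite mulr0 !val_ge0.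
have xy0 : x * y != 0 by rewrite mulf_neq0.
by rewrite !val_geE ?mulf_neq0 // val_mul // => kx ly; apply: lerD.
Qed.

Lemma val_ge_sum (I : Type) (s : seq I) (P : pred I) (G : I -> F) k :
  (forall i, P i -> val_ge k (G i)) -> val_ge k (\sum_(i <- s | P i) G i).
Proof.
by move=> GP; elim/big_ind: _ => // [|x y]; [exact: val_ge0 | exact: val_geD].
Qed.

Lemma val_ge_exp k x n : val_ge k x -> val_ge (k *+ n) (x ^+ n).
Proof.
move=> kx; elim: n => [|n IH].
  by rewrite expr0 mulr0n val_geE ?oner_eq0 ?val_one.
by rewrite exprS mulrS; apply: val_geM.
Qed.

Lemma val_inv x : x != 0 -> v x^-1 = - v x.
Proof.
move=> x0; have := val_mul x0 (_ : x^-1 != 0).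
by rewrite invr_eq0 mulfV // val_one => /(_ x0); lia.
Qed.

(** If [x + y] had a larger valuation than [x], so would [x = (x + y) - y]. *)
Lemma valD_dominant x y :
  x != 0 -> val_ge (v x + 1) y -> x + y != 0 /\ v (x + y) = v x.
Proof.
move=> x0 hy.
have lo : val_ge (v x) (x + y).
  by apply: val_geD; [rewrite val_geE | apply: val_ge_le hy; lia].
have hi : ~~ val_ge (v x + 1) (x + y).
  apply/negP => hxy; have : val_ge (v x + 1) (x + y - y).
    by apply: val_geD => //; rewrite val_geN.
  by rewrite addrK val_geE //; lia.
have xy0 : x + y != 0 by apply: contraNneq hi => ->; apply: val_ge0.
by split => //; move: lo hi; rewrite !val_geE //; lia.
Qed.

Section Weight.
Variables (D r : int).
Hypothesis D_gt0 : 0 < D.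

(** Up to the factor [D], the valuation of the [i]-th term of [g] when the
    indeterminate is given valuation [r / D]. *)
Definition wt (g : {poly F}) (i : nat) : int := D * v g`_i + r * i%:Z.

(** Only the first index of minimal weight is useful: it is what singles out one
    dominant term in a coefficient of a product. *)
Lemma first_min_wt (g : {poly F}) : g != 0 ->
  exists i, [/\ g`_i != 0, forall j, g`_j != 0 -> wt g i <= wt g j &
    forall j, (j < i)%N -> g`_j != 0 -> wt g i < wt g j].
Proof.
move=> g0; pose isMin i := (g`_i != 0) &&
  [forall j : 'I_(size g), (g`_j != 0) ==> (wt g i <= wt g j)].
have isMinP i : isMin i -> g`_i != 0 /\ forall j, g`_j != 0 -> wt g i <= wt g j.
  case/andP=> gi /forallP mi; split=> // j gj.
  have ltj : (j < size g)%N.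
    by rewrite ltnNge; apply: contra gj => /leq_sizeP/(_ j (leqnn j))->.
  by have /implyP := mi (Ordinal ltj); apply.
have lt0 : ((size g).-1 < size g)%N by rewrite prednK ?size_poly_gt0.
have ex : exists i, isMin i.
  pose P := [pred i : 'I_(size g) | g`_i != 0].
  have P0 : P (Ordinal lt0) by rewrite /= -lead_coefE lead_coef_eq0.
  case: (arg_minP (fun i : 'I_(size g) => wt g i) P0) => i gi mi.
  exists (val i); rewrite /isMin [_ != 0]gi; apply/forallP => j.
  by apply/implyP; exact: mi.
case: (ex_minnP ex) => i /isMinP[gi mi] fi; exists i; split=> // j ltj gj.
rewrite lt_neqAle mi // andbT; apply/eqP => eqw.
suff /fi : isMin j by rewrite leqNgt ltj.
by rewrite /isMin gj; apply/forallP => k; apply/implyP; rewrite -eqw; apply: mi.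
Qed.

(** A Gauss lemma: minimal weights add up. In the coefficient of index [i + j],
    where [i] and [j] are the first indices of minimal weight, any other product
    [g`_k * h`_(i + j - k)] has [k < i] or [i + j - k < j], so its weight is
    larger; as the index is the same, its valuation is larger too. *)
Lemma min_wt_mul (g h : {poly F}) : g != 0 -> h != 0 ->
  exists i j, [/\ forall k, g`_k != 0 -> wt g i <= wt g k,
    forall k, h`_k != 0 -> wt h j <= wt h k, (g * h)`_(i + j) != 0 &
    wt (g * h) (i + j) = wt g i + wt h j].
Proof.
move=> /first_min_wt[i [gi mi fi]] /first_min_wt[j [hj mj fj]].
exists i, j.
have gh0 : g`_i * h`_j != 0 by rewrite mulf_neq0.
have lti : (i < (i + j).+1)%N by rewrite ltnS leq_addr.
suff [nz vE] : (g * h)`_(i + j) != 0 /\ v (g * h)`_(i + j) = v (g`_i * h`_j).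
  by split=> //; rewrite /wt vE val_mul // PoszD !mulrDr; ring.
rewrite coefM (bigD1 (Ordinal lti)) //= addKn; apply: valD_dominant => //.
apply: val_ge_sum => k nki.
have {}nki : (k : nat) != i by apply: contraNneq nki => e; apply/eqP/val_inj.
have [->|gk] := eqVneq g`_k 0; first by rewrite mul0r val_ge0.
have [->|hl] := eqVneq h`_(i + j - k) 0; first by rewrite mulr0 val_ge0.
rewrite val_geE ?mulf_neq0 // !val_mul //.
have lek : (k <= i + j)%N by rewrite -ltnS.
have hlt : wt g i + wt h j < wt g k + wt h (i + j - k).
  have [ltki|] := ltnP k i; first by apply: ltr_leD; [apply: fi | apply: mj].
  rewrite leq_eqVlt eq_sym (negPf nki) /= => ltik.
  by apply: ler_ltD; [apply: mi | apply: fj => //; lia].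
have hk : (i + j - k)%:Z = i%:Z + j%:Z - k%:Z by lia.
move: hlt; rewrite /wt hk => hlt; clear -hlt D_gt0.
have : D * (v g`_i + v h`_j) < D * (v g`_k + v h`_(i + j - k)).
  rewrite -(ltrD2r (r * (i%:Z + j%:Z))).
  move: (v _) (v _) (v _) (v _) hlt => a b a' b' hlt.
  by congr (_ < _) : hlt; ring.
by rewrite ltr_pM2l // lezD1.
Qed.

End Weight.

(** The arithmetic of the Dumas criterion: [wh] and [wg] are the minimal weights
    of two factors of degrees [m] and [n], [lh], [lg] and [ch], [cg] the
    valuations of their leading and constant coefficients. The upper bounds on
    [wh + wg] add up to the lower bound, so all of them are equalities, and the
    two ends of the Newton polygon of a factor have the same weight. *)
Lemma newton_equality (D r lh lg ch cg wh wg m n : int) :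
    D * r <= wh + wg -> wh <= D * lh + r * m -> wg <= D * lg + r * n ->
    wh <= D * ch -> wg <= D * cg -> ch + cg = r -> lh + lg = 0 -> m + n = D ->
  D * ch = D * lh + r * m.
Proof.
move=> ge lh_ge lg_ge ch_ge cg_ge /esym vc /eqP.
rewrite addrC addr_eq0 => /eqP vl.
move=> /esym vD; subst D; subst r; subst lg.
lia.
Qed.

(** For a factor [h] of [p], equality of the weights at both ends of its Newton
    polygon says that [D] divides [r * deg h], hence [deg h], so [h] has degree
    0 or [D]. *)
Theorem dumas_irreducible (p : {poly F}) (D : nat) (r : int) :
    (0 < D)%N -> size p = D.+1 -> coprimez r D ->
    v (lead_coef p) = 0 -> p`_0 != 0 -> v p`_0 = r ->
    (forall i, p`_i != 0 -> D%:Z * r <= wt D r p i) ->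
  irreducible_poly p.
Proof.
move=> D0 szp cop vlead p0 vp0 newton.
have pn0 : p != 0 by rewrite -size_poly_eq0 szp.
split=> [|g szg]; first by rewrite szp.
case/dvdpP=> h ph.
have h0 : h != 0 by apply: contraNneq pn0 => h0; rewrite ph h0 mul0r.
have g0 : g != 0 by apply: contraNneq pn0 => g0; rewrite ph g0 mulr0.
have [i [j [mi mj nz wE]]] := @min_wt_mul D r (D0 : 0 < D%:Z) _ _ h0 g0.
have wge := newton (i + j)%N; rewrite ph wE in wge; have {nz}wge := wge nz.
have lh := mi (size h).-1; rewrite /wt -lead_coefE lead_coef_eq0 in lh.
have lg := mj (size g).-1; rewrite {1}/wt -lead_coefE lead_coef_eq0 in lg.
move: p0 vp0; rewrite ph coef0M mulf_eq0 negb_or => /andP[ch0 cg0].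
rewrite val_mul // => vc; have zh := mi 0%N ch0; have zg := mj 0%N cg0.
have {lh}lh := lh h0; have {lg}lg := lg g0.
move: vlead; rewrite ph lead_coefM val_mul ?lead_coef_eq0 // => vlead.
have sz : ((size h).-1 + (size g).-1)%N = D.
  have := size_mul h0 g0; rewrite -ph szp.
  move: (size_poly_gt0 h) (size_poly_gt0 g); rewrite h0 g0.
  by move: (size _) (size _) => a b; lia.
have key : D%:Z * v h`_0 = D%:Z * v (lead_coef h) + r * (size h).-1%:Z.
  apply: newton_equality wge lh lg _ _ vc vlead _.
  - by move: zh; rewrite [X in _ <= X]/wt mulr0 addr0.
  - by move: zg; rewrite [X in _ <= X]/wt mulr0 addr0.
  - by rewrite -sz.
have : (D %| (size h).-1)%N.
  rewrite -[(D %| _)%N]/(D%:Z %| (size h).-1%:Z)%Z.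
  rewrite -(@Gauss_dvdzr D r); last by rewrite coprimez_sym.
  apply/dvdzP; exists (v h`_0 - v (lead_coef h)).
  by rewrite mulrBl ![_ * D%:Z]mulrC key; lia.
have szg' : (0 < (size g).-1)%N by move: (size_poly_gt0 g); rewrite g0; lia.
have [szh|szh] := posnP (size h).-1; last by move/(dvdn_leq szh); lia.
move=> _; have /size_poly1P[a a0 ->] : size h == 1%N.
  by move: (size_poly_gt0 h); rewrite h0; lia.
by rewrite mul_polyC eqp_sym eqp_scale.
Qed.

(** * Iterates of ['X^d + c] *)

Section Iterates.
Variables (d : nat) (c : F).
Hypotheses (d_gt1 : (1 < d)%N) (c_neq0 : c != 0) (vc_gt0 : 0 < v c).

Let f : {poly F} := 'X^d + c%:P.

Lemma poly_iterS n : poly_iter f n.+1 = poly_iter f n ^+ d + c%:P.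
Proof. by rewrite /poly_iter iterS /f comp_polyD comp_Xn_poly comp_polyC. Qed.

(** The iterate is ['X^(d ^ n)] modulo elements of valuation at least [v c]:
    [d]-th powers preserve this congruence, and adding [c] does not affect
    it. *)
Lemma poly_iter_shape n :
  [/\ poly_iter f n \is monic, size (poly_iter f n) = (d ^ n).+1 &
    forall i, (i < d ^ n)%N -> val_ge (v c) (poly_iter f n)`_i].
Proof.
elim: n => [|n [mon sz IH]].
  split; [exact: monicX | by rewrite size_polyX | case=> // _].
  by rewrite coefX val_ge0.
have d_gt0 : (0 < d)%N by exact: ltnW.
set g := poly_iter f n in mon sz IH *.
have szgd : size (g ^+ d) = (d ^ n.+1).+1.
  rewrite -[LHS]prednK ?size_poly_gt0 ?monic_neq0 ?monic_exp //.
  by rewrite size_exp sz expnSr.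
have szc : (size (c%:P : {poly F}) < size (g ^+ d))%N.
  by rewrite szgd size_polyC c_neq0 ltnS expn_gt0 d_gt0.
rewrite poly_iterS -/g; split.
- by rewrite monicE lead_coefDl // -monicE monic_exp.
- by rewrite size_polyDl.
have g_ge i : val_ge 0 g`_i.
  have [lti|] := ltnP i (d ^ n).
    by apply: val_ge_le (IH i lti); apply: ltW.
  rewrite leq_eqVlt => /orP[/eqP<-|lti].
    have -> : g`_(d ^ n) = 1 by move/monicP: mon; rewrite lead_coefE sz.
    by rewrite val_geE ?oner_eq0 ?val_one.
  by rewrite nth_default ?sz ?val_ge0.
pose h := g - 'X^(d ^ n).
have h_ge i : val_ge (v c) h`_i.
  rewrite coefB coefXn; have [->|ne] := eqVneq i (d ^ n)%N.
    by move/monicP: mon; rewrite lead_coefE sz /= => ->; rewrite subrr val_ge0.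
  rewrite subr0; have [lti|] := ltnP i (d ^ n); first exact: IH.
  rewrite leq_eqVlt eq_sym (negPf ne) /= => lti.
  by rewrite nth_default ?sz ?val_ge0.
have gm_ge m i : val_ge (v c) (g ^+ m - 'X^(d ^ n * m))`_i.
  elim: m i => [|m IHm] i; first by rewrite muln0 expr0 subrr coef0 val_ge0.
  have -> : g ^+ m.+1 - 'X^(d ^ n * m.+1) =
      g * (g ^+ m - 'X^(d ^ n * m)) + h * 'X^(d ^ n * m).
    by rewrite /h exprS mulnS exprD; ring.
  rewrite coefD coefMXn; apply: val_geD; last first.
    by case: ifP => _; rewrite ?val_ge0.
  rewrite coefM; apply: val_ge_sum => j _; rewrite -[v c]add0r.
  exact: val_geM.
move=> i lti; rewrite coefD; apply: val_geD.
  have := gm_ge d i; rewrite coefB coefXn.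
  by rewrite [X in i == X]mulnC -expnS ltn_eqF // subr0.
by rewrite coefC; case: ifP => _; rewrite ?val_ge0 ?val_geE.
Qed.

Theorem poly_iter_irreducible n :
  coprimez (v c) d -> (0 < n)%N -> irreducible_poly (poly_iter f n).
Proof.
case: n => // n cop _; have d_gt0 : (0 < d)%N by exact: ltnW.
have [mon sz ge_vc] := poly_iter_shape n.+1.
have [_ _ ge_vc'] := poly_iter_shape n.
have [nz vE] : (poly_iter f n.+1)`_0 != 0 /\ v (poly_iter f n.+1)`_0 = v c.
  rewrite poly_iterS coefD coefC /= -horner_coef0 horner_exp horner_coef0.
  rewrite addrC; apply: valD_dominant => //.
  have := val_ge_exp d (ge_vc' 0%N _); rewrite expn_gt0 d_gt0 => /(_ isT).
  apply: val_ge_le; apply: le_trans (_ : v c *+ 2 <= _).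
    by rewrite mulr2n lerD2l -[1]add0r lezD1.
  by rewrite ler_pMn2l.
apply: (@dumas_irreducible _ (d ^ n.+1) (v c)) => //.
- by rewrite expn_gt0 d_gt0.
- by rewrite coprimezE absz_nat coprimeXr // -[d]absz_nat -coprimezE.
- by rewrite (monicP mon) val_one.
move=> i nzi; rewrite /wt; have [lti|] := ltnP i (d ^ n.+1).
  apply: le_trans (_ : (d ^ n.+1)%:Z * v (poly_iter f n.+1)`_i <= _).
    by rewrite ler_wpM2l // -val_geE // ge_vc.
  by rewrite lerDl mulr_ge0 // ltW.
rewrite leq_eqVlt => /orP[/eqP<-|lti]; last first.
  by rewrite nth_default ?sz ?eqxx in nzi.
have -> : (poly_iter f n.+1)`_(d ^ n.+1) = 1.
  by move/monicP: mon; rewrite lead_coefE sz.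
by rewrite val_one mulr0 add0r mulrC.
Qed.

End Iterates.
End Valuation.

(** * Algebraic integers as roots of integer polynomials *)

Section Integrality.
Variable K : fieldExtType rat.
Local Notation O := (ringOfIntegers K).
Implicit Types (x : K) (R : {poly K}).

Lemma val_algInt (a : O) : (a : K) \in @algInt K.
Proof. exact: valP. Qed.

Lemma int_algInt (m : int) : (m%:~R : K) \in @algInt K.
Proof. by rewrite rpred_int. Qed.

Lemma algInt_lift x : x \in @algInt K -> exists a : O, (a : K) = x.
Proof. by move=> xO; exists (RingOfIntegers xO). Qed.

Lemma algInt_root_monic R x : R \is monic -> root R x ->
  R \is a polyOver (@algInt K) -> x \in @algInt K.
Proof.
move=> mon rx /polyOverP RO; apply/algIntP.
apply: (@integral_root_monic _ _ [the {rmorphism int -> K} of intr] _ _ mon rx).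
by apply/integral_poly => i; exact: elimT (algIntP _) (RO i).
Qed.

(** If [a] is the leading coefficient and [n] the degree, multiplying the
    equation by [a ^+ n.-1] turns it into a monic equation for [a * x]. The
    degree enters only as a bound, so the coefficient may also vanish. *)
Lemma algInt_lead_mul R n x : R \is a polyOver (@algInt K) ->
  (size R <= n.+1)%N -> R.[x] = 0 -> R`_n * x \in @algInt K.
Proof.
move=> /polyOverP RO szR rx; set a := R`_n.
case: n => [|n] in szR a *.
  move: rx; rewrite [R]size1_polyC // hornerC => R0.
  by rewrite /a R0 mul0r rpred0.
pose T := \poly_(i < n.+1) (R`_i * a ^+ (n - i)).
have szT : (size T < size ('X^(n.+1) : {poly K}))%N.
  by rewrite size_polyXn ltnS size_poly.
apply: (@algInt_root_monic ('X^(n.+1) + T)).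
- by rewrite monicE lead_coefDl // lead_coefXn.
- rewrite /root hornerD hornerXn horner_poly.
  apply/eqP; transitivity (a ^+ n * R.[x]); last by rewrite rx mulr0.
  rewrite (horner_coef_wide _ szR) [X in _ = _ * X]big_ord_recr /= -/a.
  rewrite mulrDr [LHS]addrC.
  congr (_ + _); last by rewrite exprMn exprS; ring.
  rewrite mulr_sumr; apply: eq_bigr => i _.
  have lei : (i <= n)%N by rewrite -ltnS.
  have -> : a ^+ n = a ^+ (n - i) * a ^+ i by rewrite -exprD subnK.
  by rewrite exprMn; ring.
rewrite rpredD ?rpredX ?polyOverX //; apply/polyOverP => i.
rewrite coef_poly; case: ifP => _; last exact: rpred0.
by rewrite rpredM ?rpredX // RO.
Qed.

Lemma drop_polyS R k x :
  (drop_poly k R).[x] = R`_k + x * (drop_poly k.+1 R).[x].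
Proof.
have -> : drop_poly k R = (R`_k)%:P + 'X * drop_poly k.+1 R.
  apply/polyP => i; rewrite coefD coefC coefXM !coef_drop_poly.
  by case: i => [|i] /=; rewrite ?addr0 // add0r addSnnS.
by rewrite hornerD hornerC hornerM hornerX.
Qed.

(** The value of [drop_poly k R] at [x] is a tail of the Horner scheme. It is
    the leading coefficient of a polynomial of degree [k] that vanishes at [x]
    and has the same lower coefficients as [R], so [algInt_lead_mul] passes from
    one tail to the next longer one. *)
Lemma algInt_horner_drop R x k : R \is a polyOver (@algInt K) -> R.[x] = 0 ->
  (drop_poly k R).[x] \in @algInt K /\ x * (drop_poly k R).[x] \in @algInt K.
Proof.
move=> RO rx.
have mulx j : (drop_poly j R).[x] \in @algInt K ->
    x * (drop_poly j R).[x] \in @algInt K.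
  move=> bO; set b := _.[x] in bO *.
  pose S := take_poly j R + b *: 'X^j.
  have Sj : S`_j = b.
    by rewrite coefD coef_take_poly ltnn add0r coefZ coefXn eqxx mulr1.
  rewrite mulrC -Sj; apply: algInt_lead_mul.
  - rewrite rpredD ?polyOverZ ?rpredX ?polyOverX //; apply/polyOverP => i.
    rewrite coef_take_poly; case: ifP => _; rewrite ?rpred0 //.
    exact: (polyOverP RO).
  - rewrite (leq_trans (size_polyD _ _)) // geq_max.
    rewrite (leq_trans (size_take_poly _ _)) //.
    by rewrite (leq_trans (size_scale_leq _ _)) // size_polyXn.
  rewrite /S /b -[RHS]rx -[in RHS](poly_take_drop j R).
  by rewrite !hornerD hornerZ hornerM.
suff bO : (drop_poly k R).[x] \in @algInt K by split=> //; exact: mulx.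
have [m] := ubnP (size R - k); elim: m k => // m IH k lt_m.
have [le_szk|lt_ksz] := leqP (size R) k.
  by rewrite drop_poly_eq0 // horner0 rpred0.
rewrite drop_polyS rpredD ?(polyOverP RO) // mulx //.
by apply: IH; lia.
Qed.

(** Clear denominators and divide by the content. *)
Lemma primitive_multiple (q : {poly rat}) (l : nat) : (1 < l)%N -> q != 0 ->
  exists r : {poly int}, exists2 a : rat, a != 0 &
    map_poly intr r = a *: q /\ exists i, ~~ (l %| r`_i)%Z.
Proof.
move=> l1 q0; have [r0 [a a0 qE]] := rat_poly_scale q.
have r00 : r0 != 0.
  by apply: contraNneq q0 => r00; rewrite qE r00 map_poly0 scaler0.
set z := zcontents r0; have z0 : z%:~R != 0 :> rat.
  by rewrite intr_eq0 zcontents_eq0.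
have rE : map_poly intr r0 =
    z%:~R *: map_poly (intr : int -> rat) (zprimitive r0).
  by rewrite {1}[r0]zpolyEprim map_polyZ.
exists (zprimitive r0), (z%:~R^-1 * a%:~R).
  by rewrite mulf_neq0 ?invr_eq0 // intr_eq0.
split.
  by rewrite qE rE !scalerA mulfK ?intr_eq0 // mulVf // scale1r.
apply: contrapT => all_dvd.
have : zprimitive r0 \is a polyOver (dvdz l).
  apply/polyOverP => i; apply: contrapT => /negP ndvd.
  by apply: all_dvd; exists i.
rewrite -dvdz_contents zcontents_primitive r00 dvdz1 /=.
by move=> /eqP l_1; rewrite l_1 in l1.
Qed.

Lemma primitive_equation x (l : nat) : (1 < l)%N ->
  exists2 r : {poly int},
    (map_poly intr r).[x] = 0 & exists i, ~~ (l %| r`_i)%Z.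
Proof.
move=> l1; have /polyOver1P[q qE] := minPolyOver 1 x.
have q0 : q != 0.
  have := monic_neq0 (monic_minPoly 1 x); rewrite qE; apply: contraNneq => ->.
  by rewrite map_poly0.
have [r [a a0 [rE r_prim]]] := primitive_multiple l1 q0; exists r => //.
have -> : map_poly intr r = map_poly (in_alg K) (map_poly intr r).
  rewrite -map_poly_comp; apply: eq_map_poly => m.
  exact: esym (rmorph_int (in_alg K) m).
by rewrite rE map_polyZ hornerZ -qE minPolyxx mulr0.
Qed.

Lemma integral_equation (a : O) :
  exists2 q : {poly int}, q \is monic & (map_poly (intr : int -> O) q).[a] = 0.
Proof.
have [q mon_q /eqP qa] := elimT (algIntP _) (val_algInt a).
exists q => //; apply: val_inj; rewrite -horner_map -map_poly_comp /=.
rewrite -[RHS]qa; congr (_.[_]); apply: eq_map_poly => m /=.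
exact: (rmorph_int (val : O -> K)).
Qed.

End Integrality.

(** * The localization at a prime is a valuation ring *)

Section Localization.
Variables (K : fieldExtType rat) (p : prime_idealr (ringOfIntegers K)).
Local Notation O := (ringOfIntegers K).
Implicit Types (x y : K) (a b : O).

Lemma toKM a b : (a * b : O) = (a : K) * (b : K) :> K.
Proof. exact: (rmorphM (val : O -> K)). Qed.

Lemma toKD a b : (a + b : O) = (a : K) + (b : K) :> K.
Proof. exact: (rmorphD (val : O -> K)). Qed.

Lemma toKN a : (- a : O) = - (a : K) :> K.
Proof. exact: (rmorphN (val : O -> K)). Qed.

Lemma toK_int (m : int) : (m%:~R : O) = m%:~R :> K.
Proof. exact: (rmorph_int (val : O -> K)). Qed.

Lemma toKX a n : (a ^+ n : O) = (a : K) ^+ n :> K.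
Proof. exact: (rmorphXn (val : O -> K)). Qed.

Lemma toK_inj a b : (a : K) = b -> a = b.
Proof. exact: val_inj. Qed.

Lemma toK_eq0 a : ((a : K) == 0) = (a == 0).
Proof. by rewrite -(inj_eq val_inj); rewrite (rmorph0 (val : O -> K)). Qed.

(** Fractions with numerator in [J] and denominator outside [p]: they form the
    localization [loc] at [p] when [J] is everything, and its maximal ideal
    [maxl] when [J] is [p]. *)
Definition frac (J : pred O) x : Prop :=
  exists a b : O, [/\ J a, b \notin p & x * (b : K) = (a : K)].

Definition loc : K -> Prop := frac predT.

Definition maxl : K -> Prop := frac (mem p).

Lemma notinM a b : a \notin p -> b \notin p -> a * b \notin p.
Proof. by move=> na nb; rewrite prime_idealrM negb_or na. Qed.

Lemma notin_neq0 b : b \notin p -> (b : K) != 0.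
Proof. by rewrite toK_eq0; apply: contraNneq => ->; rewrite rpred0. Qed.

Lemma fracD (J : pred O) x y :
    (forall a b, J a -> J b -> J (a + b)) -> (forall a b, J a -> J (b * a)) ->
  frac J x -> frac J y -> frac J (x + y).
Proof.
move=> JD JM [a [b [Ja nb xE]]] [a' [b' [Ja' nb' yE]]].
exists (b' * a + b * a'), (b * b'); split; first by apply: JD; apply: JM.
  exact: notinM.
by rewrite toKD !toKM -xE -yE; ring.
Qed.

Lemma locD x y : loc x -> loc y -> loc (x + y).
Proof. exact: fracD. Qed.

Lemma maxlD x y : maxl x -> maxl y -> maxl (x + y).
Proof.
by apply: fracD => [a b|a b]; rewrite !inE; [apply: rpredD | apply: idealMr].
Qed.

Lemma loc_maxlM x y : loc x -> maxl y -> maxl (x * y).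
Proof.
move=> [a [b [_ nb xE]]] [a' [b' [Ja' nb' yE]]].
exists (a * a'), (b * b'); split; [exact: idealMr | exact: notinM |].
by rewrite !toKM -xE -yE; ring.
Qed.

Lemma locM x y : loc x -> loc y -> loc (x * y).
Proof.
move=> [a [b [_ nb xE]]] [a' [b' [Ja' nb' yE]]].
exists (a * a'), (b * b'); split; [by [] | exact: notinM |].
by rewrite !toKM -xE -yE; ring.
Qed.

Lemma loc_toK a : loc (a : K).
Proof. by exists a, 1; split; rewrite ?idealr1 // mulr1. Qed.

Lemma maxl_toK a : a \in p -> maxl (a : K).
Proof. by exists a, 1; split; rewrite ?idealr1 // mulr1. Qed.

Lemma toK_maxl a : maxl (a : K) -> a \in p.
Proof.
move=> [a' [b [pa' nb]]]; rewrite -toKM => /toK_inj aE.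
by move: pa'; rewrite -aE /= prime_idealrM (negPf nb) orbF.
Qed.

Lemma loc_int (m : int) : loc m%:~R.
Proof. by rewrite -toK_int; apply: loc_toK. Qed.

Lemma loc1 : loc 1.
Proof. exact: (loc_int 1). Qed.

Lemma maxl1 : ~ maxl 1.
Proof. by move=> /(@toK_maxl 1); rewrite idealr1. Qed.

Lemma locX x n : loc x -> loc (x ^+ n).
Proof.
by move=> lx; elim: n => [|n IH]; [exact: loc1 | rewrite exprS; apply: locM].
Qed.

Lemma maxl_loc x : maxl x -> loc x.
Proof. by move=> [a [b [_ nb xE]]]; exists a, b. Qed.

Lemma maxl_sum (I : Type) (s : seq I) (P : pred I) (G : I -> K) :
  (forall i, P i -> maxl (G i)) -> maxl (\sum_(i <- s | P i) G i).
Proof.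
move=> GP; elim/big_ind: _ => // [|x y]; last exact: maxlD.
by apply: (@maxl_toK 0); rewrite rpred0.
Qed.

Lemma locV x : x != 0 -> loc x -> ~ maxl x -> loc x^-1.
Proof.
move=> x0 [a [b [_ nb xE]]] nx; exists b, a; split=> //.
  by apply/negP => pa; apply: nx; exists a, b.
by rewrite -xE mulKf.
Qed.

Hypothesis p_neq0 : exists2 x, x \in p & x != 0.

(** Once factors ['X] are removed from an integral equation of [a], its constant
    coefficient is a multiple of [a]. *)
Lemma divides_int a : a != 0 ->
  exists2 m : int, m != 0 & exists b, m%:~R = a * b.
Proof.
move=> a0.
have [q mon_q qa] := integral_equation a; move: qa.
have {mon_q} : q != 0 by exact: monic_neq0.
elim/poly_ind: q => [|q c IH]; first by rewrite eqxx.
rewrite rmorphD rmorphM /= map_polyX map_polyC /= hornerMXaddC.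
have [->|c0] := eqVneq c 0.
  rewrite addr0 mulf_eq0 polyX_eq0 orbF addr0 => q0 qa; apply: IH => //.
  apply: toK_inj; apply/eqP; rewrite toK_eq0.
  move/(congr1 (@ringOfIntegers_val K))/eqP: qa; rewrite toKM.
  by rewrite mulf_eq0 !toK_eq0 (negPf a0) orbF.
move=> _ /eqP; rewrite addrC addr_eq0 => /eqP cE.
by exists c => //; exists (- (map_poly intr q).[a]); rewrite cE mulrN mulrC.
Qed.

(** The least positive integer in [p] is prime and generates the trace of [p] on
    the rational integers. *)
Lemma residue_char : exists2 l : nat, prime l &
  (l%:R : O) \in p /\ forall m : int, (m%:~R : O) \in p -> (l %| m)%Z.
Proof.
have [x px /divides_int[m m0 [b mE]]] := p_neq0.
pose S n := (0 < n)%N && ((n%:R : O) \in p).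
have exS : exists n, S n.
  exists `|m|%N; rewrite /S absz_gt0 m0 /=.
  have : (m%:~R : O) \in p by rewrite mE mulrC idealMr.
  by case: (intP m) => [|n|n]; rewrite ?abszN ?rmorphN ?rpredN.
case: (ex_minnP exS) => l /andP[l0 pl] minl.
have dvdl (m' : int) : (m'%:~R : O) \in p -> (l %| m')%Z.
  move=> pm; apply/dvdz_mod0P; apply/eqP.
  have ge0 : 0 <= (m' %% l)%Z by rewrite modz_ge0 // eqz_nat -lt0n.
  have lt_l : (m' %% l)%Z < l by rewrite ltz_pmod.
  case Em : (m' %% l)%Z ge0 lt_l => [n|//] _ ltn.
  apply/eqP; congr Posz; apply/eqP; rewrite -leqn0 leqNgt; apply/negP => n0.
  suff : S n by move/minl; rewrite leqNgt -ltz_nat ltn.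
  rewrite /S n0 -[n%:R]/((Posz n)%:~R) -Em.
  have -> : (m' %% l)%Z = m' - (m' %/ l)%Z * l.
    by rewrite {2}(divz_eq m' l); ring.
  by rewrite rmorphB rmorphM /= rpredB // idealMr.
exists l => //; apply/primeP; split.
  rewrite ltn_neqAle l0 andbT; apply/eqP => l1.
  by move: pl; rewrite -l1 idealr1.
move=> d /dvdnP[e lE]; move: (pl); rewrite lE natrM prime_idealrM.
have [e0 d0] : (0 < e)%N /\ (0 < d)%N.
  by split; rewrite lt0n; apply: contraTneq l0 => z; rewrite lE z ?muln0.
case/orP=> pe.
  have : (l <= e)%N by apply: minl; rewrite /S e0.
  by rewrite lE -{2}[e]muln1 leq_pmul2l // => d1; rewrite eqn_leq d1 d0.
have : (l <= d)%N by apply: minl; rewrite /S d0.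
rewrite lE -{2}[d]mul1n leq_pmul2r // => e1.
by apply/orP; right; rewrite -[X in X == _]mul1n eqn_pmul2r // eqn_leq e0.
Qed.

(** If neither [x] nor its inverse were in [loc], all the Horner tails [b] of a
    primitive equation for [x], and all the [c = x * b], would lie in [p], for
    [x = c / b]. The coefficient of index [i] is the [i]-th [b] minus the next
    [c], so all the coefficients would be divisible by [l]. *)
Lemma loc_or_locV x : x != 0 -> loc x \/ loc x^-1.
Proof.
move=> x0; have [l /prime_gt1 l1 [_ dvdl]] := residue_char.
have [r rx [i ndvd]] := primitive_equation x l1.
have RO : map_poly intr r \is a polyOver (@algInt K).
  by apply/polyOverP => j; rewrite coef_map int_algInt.
apply: contrapT => /not_orP[nx nxV].
have bc k : exists b c : O, [/\ (b : K) = (drop_poly k (map_poly intr r)).[x],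
    (c : K) = x * (drop_poly k (map_poly intr r)).[x], b \in p & c \in p].
  have [/algInt_lift[b bE] /algInt_lift[c cE]] := algInt_horner_drop k RO rx.
  exists b, c; split=> //; apply: contrapT => /negP np.
    by apply: nx; exists c, b; split; rewrite ?bE.
  by apply: nxV; exists b, c; split; rewrite // cE bE mulKf.
case/negP: ndvd; apply: dvdl.
have [b [_ [bE _ pb _]]] := bc i; have [_ [c [_ cE _ pc]]] := bc i.+1.
have -> : (r`_i)%:~R = b - c :> O; last by rewrite rpredB.
apply: toK_inj; rewrite toK_int toKD toKN bE cE drop_polyS coef_map /=.
by rewrite addrK.
Qed.

Lemma maxl_or_locV x : x != 0 -> maxl x \/ loc x^-1.
Proof.
move=> x0; have [|nx] := pselect (maxl x); first by left.
by case: (loc_or_locV x0) => lx; right => //; apply: locV.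
Qed.

(** * Discreteness *)

Let N := (\dim {: K}).+1.

(** The hypotheses say that the valuations of the [y i] decrease strictly, stay
    positive, and do not exceed that of [l]. There are more terms than the
    degree of [K], so they satisfy a linear relation with integer coefficients,
    not all divisible by [l]. Divide it by the term [y i] of smallest valuation
    whose coefficient is not divisible by [l]: the earlier terms become elements
    of the maximal ideal because [y j / y i] is one, the later terms because
    [l / y i] is in [loc] and [y j] in the maximal ideal. So the
    coefficient of [y i] is in the maximal ideal too, a contradiction. *)
Lemma chain_bound (l : nat) (y : nat -> K) : (1 < l)%N ->
    (forall m : int, (m%:~R : O) \in p -> (l %| m)%Z) ->
    (forall i, (i < N)%N -> y i != 0 /\ maxl (y i)) ->
    (forall i j, (i < j < N)%N -> maxl (y i / y j)) ->
    (forall i, (i < N)%N -> loc (l%:R / y i)) ->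
  False.
Proof.
move=> l1 dvdl y0 ylt ly.
have : ~~ free [tuple y i | i < N].
  rewrite /free size_tuple neq_ltn; apply/orP; left.
  by rewrite ltnS dimvS // subvf.
move/negP; apply; apply/freeP => k k_rel.
apply: contrapT => /existsNP[i0 /eqP ki0].
pose q : {poly rat} := \poly_(i < N) (if insub i is Some j then k j else 0).
have qE (i : 'I_N) : q`_i = k i by rewrite coef_poly ltn_ord valK.
have q0 : q != 0 by apply: contraNneq ki0 => q0; rewrite -qE q0 coef0.
have [r [a a0 [rE [i ndvd]]]] := primitive_multiple l1 q0.
have rk (j : nat) : (r`_j)%:~R = a * q`_j.
  by rewrite -coefZ -rE coef_map.
have r_rel : \sum_(j < N) (r`_j)%:~R * y j = 0.
  transitivity (a *: \sum_(j < N) k j *: [tuple y i | i < N]`_j).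
    rewrite scaler_sumr; apply: eq_bigr => j _.
    rewrite scalerA -qE -rk (nth_mktuple (fun i : 'I_N => y i)).
    by rewrite -[RHS]mulr_algl -[_%:A]/(in_alg K _) rmorph_int.
  by rewrite k_rel scaler0.
have r_small j : (N <= j)%N -> r`_j = 0.
  move=> leNj; have := rk j; rewrite coef_poly ltnNge leNj mulr0.
  by move/eqP; rewrite intr_eq0 => /eqP.
have bnd j : ~~ (l %| r`_j)%Z -> (j <= N)%N.
  by rewrite leqNgt => nd; apply: contra nd => /ltnW/r_small->; rewrite dvdz0.
have [{i ndvd}i ndvd maxi] := ex_maxnP (ex_intro _ i ndvd) bnd.
have ltiN : (i < N)%N.
  by rewrite ltnNge; apply: contra ndvd => /r_small->; rewrite dvdz0.
have [yi0 _] := y0 i ltiN.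
case/negP: ndvd; apply: dvdl; apply: toK_maxl; rewrite toK_int.
have -> : (r`_i)%:~R =
    \sum_(j < N | (j : nat) != i) - (r`_j)%:~R * (y j / y i) :> K.
  apply: (mulIf yi0); rewrite mulr_suml; apply/eqP.
  move: r_rel; rewrite (bigD1 (Ordinal ltiN)) //= => /eqP.
  rewrite addr_eq0 => /eqP->; rewrite -sumrN; apply/eqP; apply: eq_bigr => j _.
  by rewrite mulNr mulNr -mulrA mulfVK.
apply: maxl_sum => j nji; rewrite mulNr -mulrN.
have [ltji|] := ltnP j i.
  rewrite mulrN -mulNr -rmorphN; apply: loc_maxlM; first exact: loc_int.
  by apply: ylt; rewrite ltji.
rewrite leq_eqVlt eq_sym (negPf nji) /= => ltij.
have /dvdzP[m ->] : (l %| r`_j)%Z.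
  by apply: contrapT => /negP/maxi; rewrite leqNgt ltij.
have -> : (m * l)%:~R * - (y j / y i) = (- m)%:~R * (l%:R / y i) * y j :> K.
  by rewrite rmorphM rmorphN /=; ring.
apply: loc_maxlM; last by case: (y0 j (ltn_ord j)).
by apply: locM; [exact: loc_int | exact: ly].
Qed.

(** Without an element of smallest positive valuation one could descend for ever
    from [l], against [chain_bound]. *)
Lemma uniformizer :
  exists2 u, u != 0 /\ maxl u & forall x, maxl x -> loc (x / u).
Proof.
have [l /[dup]/prime_gt0 l0 /prime_gt1 l1 [pl dvdl]] := residue_char.
have lK0 : (l%:R : K) != 0.
  by rewrite -(rmorph_nat (in_alg K)) fmorph_eq0 pnatr_eq0 -lt0n.
apply: contrapT => no_unif.
have next u : exists x, u != 0 /\ maxl u -> [/\ x != 0, maxl x & maxl (u / x)].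
  have [[u0 mu]|] := pselect (u != 0 /\ maxl u); last by exists 0.
  have [x mx nloc] : exists2 x, maxl x & ~ loc (x / u).
    apply: contrapT => nex; apply: no_unif; exists u => // x mx.
    by apply: contrapT => nloc; apply: nex; exists x.
  have x0 : x != 0.
    apply/eqP => x0; apply: nloc; rewrite x0 mul0r; exact: (loc_int 0).
  exists x => _; split=> //.
  have ux0 : u / x != 0 by rewrite mulf_neq0 ?invr_eq0.
  by case: (maxl_or_locV ux0) => //; rewrite invf_div => /nloc.
have [g gP] := choice next.
pose y i := iter i g (l%:R : K).
have y0 i : y i != 0 /\ maxl (y i).
  elim: i => [|i IH]; last by case: (gP (y i) IH).
  split=> //; have -> : y 0%N = (Posz l)%:~R by [].
  by rewrite -toK_int; apply: maxl_toK.
have ylt i j : (i < j)%N -> maxl (y i / y j).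
  elim: j => // j IH; rewrite ltnS leq_eqVlt.
  have [_ _ step] := gP (y j) (y0 j).
  case/orP=> [/eqP->//|ltij]; have [yj0 _] := y0 j.
  have -> : y i / y j.+1 = (y i / y j) * (y j / y j.+1).
    by rewrite mulrA mulfVK.
  by apply: loc_maxlM => //; apply/maxl_loc/IH.
apply: (@chain_bound l y) => // [i j /andP[ltij _]|i _]; first exact: ylt.
case: i => [|i]; last by apply: maxl_loc; exact: (ylt 0%N).
by rewrite divff //; exact: loc1.
Qed.

Section Uniformizer.
Variable u : K.
Hypotheses (u_neq0 : u != 0) (u_max : maxl u).
Hypothesis u_div : forall x, maxl x -> loc (x / u).

Lemma uX_maxl n : (0 < n)%N -> maxl (u ^+ n).
Proof.
case: n => // n _; rewrite exprSr; apply: loc_maxlM => //.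
exact/locX/maxl_loc.
Qed.

(** The powers of [u] up to the [N]-th cannot all have valuation at most that of
    [l], by [chain_bound]; so the valuation of [l] is less than [N] times that
    of [u]. As [m] is [l ^+ e] times a unit of [loc], its valuation is at most
    [N * e] times that of [u]. *)
Lemma int_bounded_order (m : int) : m != 0 -> exists n, ~ loc (m%:~R / u ^+ n).
Proof.
have [l l_pr [pl dvdl]] := residue_char.
have lK0 : (l%:R : K) != 0.
  by rewrite -(rmorph_nat (in_alg K)) fmorph_eq0 pnatr_eq0 -lt0n prime_gt0.
have l_bound : ~ loc (l%:R / u ^+ N).
  move=> lN; apply: (@chain_bound l (fun i => u ^+ (N - i))) => //.
  - exact: prime_gt1.
  - move=> i ltiN; rewrite expf_neq0 //; split=> //.
    by apply: uX_maxl; rewrite subn_gt0.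
  - move=> i j /andP[ltij ltjN].
    have -> : (N - i = (j - i) + (N - j))%N by lia.
    by rewrite exprD mulfK ?expf_neq0 //; apply: uX_maxl; rewrite subn_gt0.
  move=> i ltiN; have -> : l%:R / u ^+ (N - i) = l%:R / u ^+ N * u ^+ i.
    rewrite -[in RHS](subnK (ltnW ltiN)) exprD invfM mulrA mulfVK //.
    by rewrite expf_neq0.
  by apply: locM => //; apply/locX/maxl_loc.
have {l_bound}ul : loc (u ^+ N / l%:R).
  have : l%:R / u ^+ N != 0 by rewrite mulf_neq0 ?invr_eq0 ?expf_neq0.
  by case/maxl_or_locV => [/maxl_loc//|]; rewrite invf_div.
move=> m0; have : (0 < `|m|)%N by rewrite absz_gt0.
case/(pfactor_coprime l_pr) => m' cop mE; set e := logn l _ in mE.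
have m'unit : loc (m'%:R)^-1.
  apply: locV; last 2 first.
  - exact: (loc_int m').
  - move=> mm'; have /dvdl : ((Posz m')%:~R : O) \in p.
      by apply: toK_maxl; rewrite toK_int.
    rewrite dvdzE /= => ldvd; move: cop.
    by rewrite prime_coprime // ldvd.
  rewrite -(rmorph_nat (in_alg K)) fmorph_eq0 pnatr_eq0.
  by apply: contra m0 => /eqP m'0; rewrite -absz_eq0 mE m'0.
exists (N * e).+1 => lm; apply: maxl1.
have mabs : loc (`|m|%:R / u ^+ (N * e).+1).
  have [mm|mm] : m = `|m|%N \/ m = - (`|m|%N : int).
  - by case: (m) => n; [left | right; rewrite NegzE].
  - by move: lm; rewrite {1}mm.
  have -> : (`|m|%N)%:R = - m%:~R :> K by rewrite {2}mm rmorphN opprK.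
  rewrite mulNr -mulN1r; apply: locM => //; exact: (loc_int (-1)).
have -> : 1 =
    (m'%:R)^-1 * (`|m|%:R / u ^+ (N * e).+1) * (u ^+ N / l%:R) ^+ e * u.
  rewrite mE natrM natrX expr_div_n -exprM exprS.
  have m'K0 : (m'%:R : K) != 0.
    rewrite -(rmorph_nat (in_alg K)) fmorph_eq0 pnatr_eq0.
    by apply: contra m0 => /eqP m'0; rewrite -absz_eq0 mE m'0.
  have uN0 : u ^+ (N * e) != 0 by rewrite expf_neq0.
  have lE0 : (l%:R : K) ^+ e != 0 by rewrite expf_neq0.
  move: (u ^+ (N * e)) (l%:R ^+ e) uN0 lE0 => U L U0 L0.
  by field; rewrite L0 U0 u_neq0 m'K0.
by apply: loc_maxlM => //; apply: locM; [exact: locM | exact: locX].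
Qed.

Lemma bounded_order x : loc x -> x != 0 -> exists n, ~ loc (x / u ^+ n).
Proof.
move=> [a [b [_ nb xE]]] x0.
have a0 : a != 0 by rewrite -toK_eq0 -xE mulf_neq0 // notin_neq0.
have [m m0 [c mE]] := divides_int a0.
have [n nloc] := int_bounded_order m0; exists n => lx; apply: nloc.
have -> : m%:~R / u ^+ n = (b : K) * (c : K) * (x / u ^+ n).
  by rewrite -toK_int mE toKM -xE; ring.
by apply: locM => //; rewrite -toKM; apply: loc_toK.
Qed.

(** Divide by [u] as long as the result stays in [loc]: the last quotient is not
    in the maximal ideal, hence is a unit. *)
Lemma exists_order x : x != 0 ->
  exists k : int, loc (x / u ^ k) /\ loc (u ^ k / x).
Proof.
suff pos y : y != 0 -> loc y ->
    exists n : nat, loc (y / u ^+ n) /\ loc (u ^+ n / y).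
  move=> x0; case: (loc_or_locV x0) => [/(pos x x0)[n xn]|]; first by exists n.
  have x'0 : x^-1 != 0 by rewrite invr_eq0.
  move=> /(pos _ x'0)[n [xn xn']]; exists (- n%:Z).
  rewrite -invr_expz -exprnP invrK mulrC; split; last by rewrite mulrC.
  by rewrite invrK in xn'.
move=> y0 ly.
have exn : exists n, `[< ~ loc (y / u ^+ n) >].
  by have [n nl] := bounded_order ly y0; exists n; apply/asboolP.
case: (ex_minnP exn) => [[|n]] /asboolP nl minn.
  by case: nl; rewrite expr0 divr1.
have ln : loc (y / u ^+ n).
  by apply: contrapT => nln; have := minn n; rewrite ltnn => /(_ (asboolT nln)).
exists n; split=> //.
have : y / u ^+ n != 0 by rewrite mulf_neq0 ?invr_eq0 ?expf_neq0.
case/maxl_or_locV => [/u_div|]; last by rewrite invf_div.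
by rewrite -mulrA -invfM -exprSr => /nl.
Qed.
End Uniformizer.
End Localization.

(** * Powers of the prime ideal and its valuation *)

Section IdealPowers.
Variable R : comNzRingType.
Variable I : prime_idealr R.
Local Notation pow := (ideal_exp [set` I]%classic).

Lemma ideal_expD n x y : pow n x -> pow n y -> pow n (x + y).
Proof.
case: n => [//|n] [s sP ->] [t tP ->]; exists (s ++ t); last by rewrite big_cat.
by move=> z; rewrite mem_cat => /orP[/sP|/tP].
Qed.

Lemma ideal_expMl n r x : pow n x -> pow n (r * x).
Proof.
case: n => [//|n] [s sP ->]; exists [seq (r * z.1, z.2) | z <- s].
  by move=> _ /mapP[z /sP[z1 z2] ->]; split=> //=; apply: idealMr.
by rewrite big_map mulr_sumr; apply: eq_bigr => z _; rewrite mulrA.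
Qed.

Lemma ideal_expX n x : x \in I -> pow n (x ^+ n).
Proof.
move=> xI; elim: n => [//|n IH]; exists [:: (x, x ^+ n)].
  by move=> z; rewrite inE => /eqP->.
by rewrite big_seq1 exprS.
Qed.

End IdealPowers.

Section Order.
Variables (K : fieldExtType rat) (p : prime_idealr (ringOfIntegers K)).
Local Notation O := (ringOfIntegers K).
Implicit Types (x y : K) (a b : O).
Local Notation loc := (loc p).
Local Notation maxl := (maxl p).
Local Notation pow := (ideal_exp [set` p]%classic).
Hypothesis p_neq0 : exists2 x, x \in p & x != 0.

(** The ideal [p] is maximal. Take an integer polynomial, nonzero modulo [l],
    with value at [a] in [p]. Factors ['X] can be removed from it modulo [l]
    since [a] is not in [p]; once its constant coefficient is prime to [l], it
    exhibits an inverse of [a] modulo [p]. *)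
Lemma inverse_mod a : a \notin p -> exists w, w * a - 1 \in p.
Proof.
move=> na; have [l l_pr [pl dvdl]] := residue_char p_neq0.
have [q mon_q qa0] := integral_equation a.
have {qa0} : (map_poly (intr : int -> O) q).[a] \in p by rewrite qa0 rpred0.
have {mon_q} : exists i, ~~ (l %| q`_i)%Z.
  exists (size q).-1; rewrite -lead_coefE (monicP mon_q).
  by rewrite dvdzE /= dvdn1 neq_ltn prime_gt1 ?orbT.
elim/poly_ind: q => [|q c IH] [i]; first by rewrite coef0 dvdz0.
rewrite rmorphD rmorphM /= map_polyX map_polyC /= hornerMXaddC.
have [lc|nlc] := boolP (l %| c)%Z.
  case: i => [|i]; first by rewrite coefD coefMX coefC add0r lc.
  rewrite coefD coefMX coefC /= addr0 => nd qa.
  apply: IH; first by exists i.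
  have pc : (c%:~R : O) \in p.
    by case/dvdzP: lc => m ->; rewrite rmorphM /= idealMr.
  move: qa; rewrite rpredDr // prime_idealrM.
  by rewrite (negPf na) orbF.
move=> _ qa.
have cop : coprimez c l.
  by rewrite coprimez_sym coprimezE /= prime_coprime.
have [e [f]] := Bezoutz c l; rewrite (eqP cop) => ef.
exists (- (e%:~R * (map_poly intr q).[a])).
have -> : - (e%:~R * (map_poly intr q).[a]) * a - 1 =
   - e%:~R * ((map_poly intr q).[a] * a + c%:~R) - f%:~R * l%:R :> O.
  have one : 1 = e%:~R * c%:~R + f%:~R * l%:R :> O.
    by rewrite -[l%:R]/((Posz l)%:~R) -!intrM -intrD ef.
  rewrite [X in _ - X]one.
  by ring.
by rewrite rpredB // idealMr.
Qed.

Variable u : K.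
Hypotheses (u_neq0 : u != 0) (u_max : maxl u).
Hypothesis u_div : forall x, maxl x -> loc (x / u).

(** From right to left, clearing denominators gives [a * s] in [p ^ n] for some
    [s] outside [p]. As [s] is invertible modulo [p], it is so modulo
    [p ^ n]. *)
Lemma ideal_exp_loc n a : pow n a <-> loc ((a : K) / u ^+ n).
Proof.
split.
  elim: n a => [a _|n IH _ [s sP ->]].
    by rewrite expr0 divr1; apply: loc_toK.
  elim: s sP => [|z s IHs] sP.
    rewrite big_nil -[X in X / _]/(val (0 : O)) rmorph0 mul0r.
    exact: (loc_int p 0).
  have [z1 z2] := sP z (mem_head _ _).
  rewrite big_cons toKD mulrDl; apply: locD; last first.
    by apply: IHs => y ys; apply: sP; rewrite inE ys orbT.
  have -> : ((z.1 * z.2 : O) : K) / u ^+ n.+1 =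
      ((z.1 : K) / u) * ((z.2 : K) / u ^+ n).
    by rewrite toKM exprS invfM mulrACA.
  by apply: locM; [apply/u_div/maxl_toK | apply: IH].
move=> [c [b [_ nb aE]]]; have [a0 [b0 [pa0 nb0 uE]]] := u_max.
set s := b * b0 ^+ n.
have ns : s \notin p.
  apply: notinM => //; elim: (n) => [|m IH]; first by rewrite expr0 idealr1.
  by rewrite exprS; apply: notinM.
have asE : a * s = c * a0 ^+ n.
  apply: toK_inj; rewrite !toKM !toKX -uE -aE exprMn.
  have un0 : u ^+ n != 0 by rewrite expf_neq0.
  by move: (u ^+ n) (_ ^+ n) un0 => U B U0; field.
have [w pw] := inverse_mod ns.
set t := w * s - 1 in pw.
(* [(- t) ^+ n] is in [p ^ n], and [w * s = 1 + t] divides [1 - (- t) ^+ n]. *)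
have -> : a = (w * (\sum_(i < n) (- t) ^+ i)) * (c * a0 ^+ n) + a * (- t) ^+ n.
  rewrite -asE; have := subrX1 (- t) n.
  have -> : - t - 1 = - (w * s) by rewrite /t; ring.
  by move=> /eqP; rewrite subr_eq => /eqP->; ring.
apply: ideal_expD.
  by apply: ideal_expMl; apply: ideal_expMl; apply: ideal_expX.
by apply: ideal_expMl; apply: ideal_expX; rewrite rpredN.
Qed.

Lemma uXz_maxl (k : int) : 0 < k -> maxl (u ^ k).
Proof. by case: k => [n|//]; rewrite ltz_nat => n0; apply: uX_maxl. Qed.

Lemma loc_uXz (k : int) : 0 <= k -> loc (u ^ k).
Proof. by case: k => [n _|//]; apply/locX/maxl_loc. Qed.

(** The product of the two members of [loc] is [u ^ (k - j)], and negative
    powers of [u] are not in [loc]. *)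
Lemma order_le x (k j : int) : x != 0 ->
  loc (u ^ k / x) -> loc (x / u ^ j) -> j <= k.
Proof.
move=> x0 lk lj; rewrite leNgt; apply/negP => ltkj; apply: (@maxl1 _ p).
have -> : 1 = (u ^ k / x) * (x / u ^ j) * u ^ (j - k).
  rewrite expfzDr // -invr_expz.
  have := expfz_neq0 k u_neq0; have := expfz_neq0 j u_neq0.
  by move: (u ^ k) (u ^ j) => U V V0 U0; field; rewrite x0 U0 V0.
by apply: loc_maxlM; [apply: locM | apply: uXz_maxl; rewrite subr_gt0].
Qed.

Lemma exists_valuation_loc : exists v : K -> int,
  is_valuation v /\ forall k x, val_ge v k x <-> loc (x / u ^ k).
Proof.
have ex x : exists k, x != 0 -> loc (x / u ^ k) /\ loc (u ^ k / x).
  have [->|x0] := eqVneq x 0; first by exists 0.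
  by have [k] := exists_order p_neq0 u_neq0 u_max u_div x0; exists k.
have [v vP] := choice ex; exists v.
have geE k x : val_ge v k x <-> loc (x / u ^ k).
  have [->|x0] := eqVneq x 0.
    by rewrite val_ge0 mul0r; split=> // _; exact: (loc_int p 0).
  rewrite val_geE //; have [lx lx'] := vP x x0.
  split=> [lek|]; last exact: order_le.
  have -> : x / u ^ k = x / u ^ v x * u ^ (v x - k).
    rewrite expfzDr // -invr_expz mulrA mulfVK //.
    by rewrite expfz_neq0.
  by apply: locM => //; apply: loc_uXz; rewrite subr_ge0.
split=> //; split=> [x y x0 y0|k x y /geE lx /geE ly]; last first.
  by apply/geE; rewrite mulrDl; apply: locD.
have xy0 : x * y != 0 by rewrite mulf_neq0.
have [lx lx'] := vP x x0; have [ly ly'] := vP y y0; have [lxy lxy'] := vP _ xy0.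
apply: le_anti; apply/andP; split.
  apply: (order_le xy0) => //.
  by rewrite expfzDr // invfM mulrACA; apply: locM.
apply: (order_le xy0) => //.
by rewrite expfzDr // invfM mulrACA; apply: locM.
Qed.

End Order.

Section PrimeValuation.
Variables (K : fieldExtType rat) (p : prime_idealr (ringOfIntegers K)).
Local Notation O := (ringOfIntegers K).
Hypothesis p_neq0 : exists2 x, x \in p & x != 0.

(** The value of [valuation p] comes from an arbitrary way of writing the
    argument as a fraction; since [v] is additive, all ways give the same
    value. *)
Theorem exists_prime_valuation : exists v : K -> int,
  [/\ is_valuation v, forall a : O, val_ge v 0 (a : K) &
      forall a : O, a != 0 -> valuation p (a : K) = v a].
Proof.
have [u [u0 umax] udiv] := uniformizer p_neq0.
have [v [v_val geE]] := exists_valuation_loc p_neq0 u0 umax udiv.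
have ge0 (a : O) : val_ge v 0 (a : K).
  by apply/geE; rewrite expr0z divr1; apply: loc_toK.
have ordE (a : O) : a != 0 -> (ideal_ord [set` p]%classic a)%:Z = v a.
  move=> a0; have := ge0 a; rewrite val_geE ?toK_eq0 //.
  case E : (v a) => [n|//] _; congr Posz.
  have powE m : ideal_exp [set` p]%classic m a <-> (m <= n)%N.
    rewrite (ideal_exp_loc p_neq0 u0 umax udiv) exprnP -geE.
    by rewrite val_geE ?toK_eq0 // E lez_nat.
  apply: xget_unique => [|m [/powE le /powE]].
    by split; apply/powE; rewrite ?ltnn.
  by move/negP; rewrite -leqNgt => ge; apply/eqP; rewrite eqn_leq le.
exists v; split=> // a a0; rewrite /valuation.
set S := (X in xget 0 X).
have : S (xget 0 S).
  apply: xgetPex; eexists; exists a, 1; split=> //; first exact: oner_neq0.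
  by rewrite -[((1 : O) : K)]/(val (1 : O)) rmorph1 divr1.
move=> [b [c [b0 c0 aE ->]]]; rewrite !ordE //.
have bE : (b : K) = (a : K) * (c : K) by rewrite aE mulfVK // toK_eq0.
by rewrite bE (val_mul v_val) ?toK_eq0 // addrK.
Qed.

End PrimeValuation.

(** * Stability *)

Theorem theorem3p2 (K : fieldExtType rat) (d : nat) (hd : (2 <= d)%N)
    (c1 c2 : ringOfIntegers K) (hc2 : c2 != 0) (hc : rel_prime c1 c2)
    (hp : exists p : prime_idealr (ringOfIntegers K),
        (exists2 x, x \in p & x != 0) /\
        gcdz (valuation p (c1 : K)) d%:Z = 1) :
  stable ('X^d + ((c1 : K) / (c2 : K))%:P).
Proof.
have [p [p_neq0 gcd1]] := hp; move=> n n_gt0.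
have val_neq0 : valuation p (c1 : K) != 0.
  apply/eqP => v0; move: gcd1; rewrite v0 gcd0z absz_nat => -[d1].
  by rewrite d1 in hd.
(* No fraction of nonzero integers is 0, so the value at 0 is the default. *)
have c1_neq0 : c1 != 0.
  apply: contraNneq val_neq0 => ->; rewrite /valuation xgetPN // => m.
  move=> [a [b [a0 b0 /esym/eqP + _]]].
  by rewrite mulf_eq0 invr_eq0 !toK_eq0 (negPf a0) (negPf b0).
have [v [v_val ge0 valE]] := exists_prime_valuation p_neq0.
rewrite valE // in gcd1 val_neq0.
have c1K : (c1 : K) != 0 by rewrite toK_eq0.
have c2K : (c2 : K) != 0 by rewrite toK_eq0.
have vc1 : 0 < v c1 by rewrite lt_def val_neq0 -val_geE ?ge0.
have vc2 : v c2 = 0.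
  have : 0 <= v c2 by rewrite -val_geE ?ge0.
  rewrite le_eqVlt => /orP[/eqP//|vc2].
  have [a [b abE]] := hc.
  have : val_ge v 1 (1 : K).
    have -> : 1 = (a : K) * (c1 : K) + (b : K) * (c2 : K).
      by rewrite -!toKM -toKD abE -[RHS]/(val (1 : ringOfIntegers K)) rmorph1.
    apply: (val_geD v_val); rewrite -[1]add0r; apply: (val_geM v_val) => //;
      by rewrite val_geE // -[1]add0r lezD1.
  by rewrite val_geE ?oner_eq0 // (val_one v_val).
have vcE : v ((c1 : K) / (c2 : K)) = v c1.
  by rewrite (val_mul v_val) ?invr_eq0 // (val_inv v_val) // vc2 oppr0 addr0.
apply: (@poly_iter_irreducible _ v) => //.
- by rewrite mulf_neq0 ?invr_eq0.
- by rewrite vcE.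
- by rewrite vcE /coprimez gcd1.
Qed.
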